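(* Let $R$ be a commutative $*$-ring and let $\mu,\eta\in R$ with $\mu^*=\mu$ and $\eta^*=\eta$. Let $R[i]=\{a+bi \mid a,b\in R,\ i^2=\mu i+\eta\}$, with involution $(a+bi)^*=a^*+b^*i$. Then $R[i]$ is strongly nil $*$-clean if and only if (1) $R$ is strongly nil $*$-clean, and (2) $\mu\eta$ is nilpotent.
   Context: All rings are associative with unity. An involution of a ring $R$ is a map $*:R\to R$ with $(x+y)^*=x^*+y^*$, $(xy)^*=y^*x^*$ and $(x^* )^*=x$ for all $x,y\in R$; a ring with an involution is called a $*$-ring. A projection in a $*$-ring is an element $p$ with $p^2=p=p^*$. A $*$-ring is strongly nil $*$-clean if every element is the sum of a projection and a nilpotent element that commute with each other. The algebraic extension $R[i]$ consists of the formal expressions $a+bi$ with $a,b\in R$ (i.e. it is $R[x]/(x^2-\mu x-\eta)$, with $i$ the class of $x$), multiplied using $i^2=\mu i+\eta$; since $\mu,\eta$ are fixed by $*$, the map $a+bi\mapsto a^*+b^*i$ is an involution on it. *)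

(* Defs.v *)
From HB Require Import structures.
From mathcomp Require Import all_boot all_algebra.
From mathcomp Require Import ring.

Set Implicit Arguments.
Unset Strict Implicit.
Unset Printing Implicit Defensive.

Import GRing.Theory.
Local Open Scope ring_scope.

(* Rings are unital and associative, and may be trivial, hence the [pz]
   ("possibly zero") structures. An involution is an unbundled function
   [star : R -> R]; the pair [(R, star)] is a *-ring. *)

Definition is_involution (R : pzRingType) (star : R -> R) : Prop :=
  [/\ {morph star : x y / x + y},
      forall x y : R, star (x * y) = star y * star x
    & involutive star].

Definition is_projection (R : pzRingType) (star : R -> R) (p : R) : Prop :=
  p ^+ 2 = p /\ star p = p.

Definition is_nilpotent (R : pzRingType) (x : R) : Prop :=
  exists n : nat, x ^+ n = 0.

Definition strongly_nil_star_clean (R : pzRingType) (star : R -> R) : Prop :=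
  forall x : R, exists p w : R,
    [/\ is_projection star p, is_nilpotent w, GRing.comm p w & x = p + w].

(* [QuadExt mu eta a b] is the formal expression [a + b i] of R[i], where
   i ^ 2 = mu i + eta. The parameters [mu] and [eta] are phantom in the record;
   they select the multiplication. *)
Record quad_ext (R : comPzRingType) (mu eta : R) : Type :=
  QuadExt { quad_re : R; quad_im : R }.

Section QuadExtRing.
Variables (R : comPzRingType) (mu eta : R).
Local Notation Q := (quad_ext mu eta).
Local Notation mk := (@QuadExt R mu eta).
Implicit Types x y z : Q.

Definition pair_of_quad x : R * R := (quad_re x, quad_im x).
Definition quad_of_pair (u : R * R) : Q := mk u.1 u.2.

Lemma pair_of_quadK : cancel pair_of_quad quad_of_pair.
Proof. by case. Qed.

HB.instance Definition _ := Choice.copy Q (can_type pair_of_quadK).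

Definition quad_zero : Q := mk 0 0.
Definition quad_opp x : Q := mk (- quad_re x) (- quad_im x).
Definition quad_add x y : Q :=
  mk (quad_re x + quad_re y) (quad_im x + quad_im y).

Lemma quad_addA : associative quad_add.
Proof. by move=> [a b] [c d] [e f]; congr mk; rewrite /= addrA. Qed.

Lemma quad_addC : commutative quad_add.
Proof. by move=> [a b] [c d]; congr mk; rewrite /= addrC. Qed.

Lemma quad_add0 : left_id quad_zero quad_add.
Proof. by move=> [a b]; congr mk; rewrite /= add0r. Qed.

Lemma quad_addN : left_inverse quad_zero quad_opp quad_add.
Proof. by move=> [a b]; congr mk; rewrite /= addNr. Qed.

HB.instance Definition _ :=
  GRing.isZmodule.Build Q quad_addA quad_addC quad_add0 quad_addN.

Definition quad_one : Q := mk 1 0.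

(* (a + b i)(c + d i) = ac + (ad + bc) i + bd i ^ 2, with i ^ 2 = mu i + eta. *)
Definition quad_mul x y : Q :=
  mk (quad_re x * quad_re y + quad_im x * quad_im y * eta)
     (quad_re x * quad_im y + quad_im x * quad_re y
      + quad_im x * quad_im y * mu).

Lemma quad_mulA : associative quad_mul.
Proof. by move=> [a b] [c d] [e f]; congr mk => /=; ring. Qed.

Lemma quad_mulC : commutative quad_mul.
Proof. by move=> [a b] [c d]; congr mk => /=; ring. Qed.

Lemma quad_mul1 : left_id quad_one quad_mul.
Proof. by move=> [a b]; congr mk => /=; ring. Qed.

Lemma quad_mulDl : left_distributive quad_mul +%R.
Proof. by move=> [a b] [c d] [e f]; congr mk => /=; ring. Qed.

HB.instance Definition _ :=
  GRing.Zmodule_isComPzRing.Build Q quad_mulA quad_mulC quad_mul1 quad_mulDl.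

Definition quad_const (a : R) : Q := mk a 0.
Definition quad_i : Q := mk 0 1.

Lemma quad_extE (a b : R) : mk a b = quad_const a + quad_const b * quad_i.
Proof. by congr mk => /=; ring. Qed.

Lemma quad_i_sqr : quad_i ^+ 2 = quad_const mu * quad_i + quad_const eta.
Proof. by rewrite expr2; congr mk => /=; ring. Qed.

Definition quad_star (star : R -> R) (x : Q) : Q :=
  mk (star (quad_re x)) (star (quad_im x)).

Lemma quad_star_involution (star : R -> R) :
  is_involution star -> star mu = mu -> star eta = eta ->
  is_involution (quad_star star).
Proof.
case=> sD sM sK smu seta; split.
- by move=> [a b] [c d]; congr mk => /=; rewrite sD.
- by move=> [a b] [c d]; congr mk; rewrite /= !(sD, sM) ?smu ?seta; ring.
- by move=> [a b]; congr mk; rewrite /= sK.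
Qed.

End QuadExtRing.

(* Main.v *)
Require Import Defs.
From mathcomp Require Import all_boot all_algebra.
From mathcomp Require Import ring.

Import GRing.Theory.
Local Open Scope ring_scope.

(** A commutative *-ring is strongly nil *-clean iff [x - x ^+ 2] is always
    nilpotent (so that idempotents lift modulo nilpotents) and every idempotent
    is self-adjoint. Modulo nilpotents such a ring is Boolean with trivial
    involution, and over a Boolean ring one computes
    [(i - i ^+ 2) ^+ 2 = mu * eta], while [z - z ^+ 2 = b * (i - i ^+ 2)] for
    [z = a + b i]; this settles the first condition. For the second, an
    idempotent of R[i] differs from its adjoint by a nilpotent, and two
    commuting idempotents with nilpotent difference are equal. *)

Section Nilpotent.
Variable R : comPzRingType.
Implicit Types x y e f : R.

Lemma nilpotentD x y :
  is_nilpotent x -> is_nilpotent y -> is_nilpotent (x + y).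
Proof.
case=> m xm0 [n yn0]; exists (m + n)%N; rewrite exprDn big1 // => i _.
have [le_in|lt_ni] := leqP i n.
  by rewrite -addnBA // exprD xm0 !mul0r mul0rn.
by rewrite -(subnK (ltnW lt_ni)) (exprD y) yn0 !mulr0 mul0rn.
Qed.

Lemma nilpotentMl x y : is_nilpotent x -> is_nilpotent (y * x).
Proof. by case=> n xn0; exists n; rewrite exprMn xn0 mulr0. Qed.

Lemma nilpotentN x : is_nilpotent x -> is_nilpotent (- x).
Proof. by rewrite -mulN1r; apply: nilpotentMl. Qed.

Lemma nilpotentB x y :
  is_nilpotent x -> is_nilpotent y -> is_nilpotent (x - y).
Proof. by move=> nx /nilpotentN; apply: nilpotentD. Qed.

Lemma nilpotent_sqr x : is_nilpotent (x ^+ 2) -> is_nilpotent x.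
Proof. by case=> n; rewrite -exprM; exists (2 * n)%N. Qed.

(** The difference [d] of two commuting idempotents satisfies [d ^+ 3 = d], hence equals arbitrarily
    high powers of itself, and so vanishes once it is nilpotent. *)
Lemma idempotent_eq_mod_nilpotent e f :
  e ^+ 2 = e -> f ^+ 2 = f -> is_nilpotent (e - f) -> e = f.
Proof.
move=> ee ff [n d0]; apply/eqP; rewrite -subr_eq0; apply/eqP.
set d := e - f in d0 *.
have dd : d * d ^+ 2 = d.
  transitivity (e * e ^+ 2 - 3 * e ^+ 2 * f + 3 * e * f ^+ 2 - f * f ^+ 2).
    by rewrite /d; ring.
  by rewrite ee ff -!expr2 ee ff /d; ring.
have ddk k : d * (d ^+ 2) ^+ k = d.
  by elim: k => [|k IHk]; rewrite ?expr0 ?mulr1 // exprS mulrA dd.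
by rewrite -(ddk n) -exprM mulnC exprM d0 expr2 mul0r mulr0.
Qed.

(* The witness [e = 1 - (1 - x ^+ n) ^+ n] is divisible by [x ^+ n], and its
   complement by [(1 - x) ^+ n]. *)
Lemma idempotent_lift x :
  is_nilpotent (x - x ^+ 2) -> exists2 e, e ^+ 2 = e & is_nilpotent (x - e).
Proof.
(* A positive exponent lets one factor of [x ^+ n] or [(1 - x) ^+ n] be split off at the end to
   complete a copy of [t = x * (1 - x)]. *)
case=> n0 xn0; set n := n0.+1; set t := x - x ^+ 2.
have tn : t ^+ n = 0 by rewrite exprS xn0 mulr0.
have tE : t = x * (1 - x) by rewrite /t; ring.
have div1 y : exists s, 1 - y ^+ n = s * (1 - y).
  exists (\sum_(i < n) y ^+ i).
  by rewrite -[X in X - _](expr1n _ n) subrXX mulrC; congr (_ * _);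
     apply: eq_bigr => i _; rewrite expr1n mul1r.
have [s sE] := div1 x; have [r rE] := div1 (1 - x ^+ n).
pose e := 1 - (1 - x ^+ n) ^+ n.
have eE : e = r * x ^+ n by rewrite /e rE; ring.
have e'E : 1 - e = s ^+ n * (1 - x) ^+ n.
  by rewrite /e opprB addrC subrK sE exprMn.
have nil_t y : is_nilpotent (y * t).
  by apply: nilpotentMl; exists n.
exists e.
  apply/eqP; rewrite eq_sym -subr_eq0; apply/eqP.
  transitivity (e * (1 - e)); first by ring.
  transitivity (r * s ^+ n * t ^+ n); last by rewrite tn mulr0.
  by rewrite e'E eE tE exprMn; ring.
have -> : x - e = x * (1 - e) - (1 - x) * e by ring.
apply: nilpotentB.
  have -> : x * (1 - e) = (s ^+ n * (1 - x) ^+ n0) * t.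
    by rewrite e'E tE [(1 - x) ^+ n]exprS; ring.
  exact: nil_t.
have -> : (1 - x) * e = (r * x ^+ n0) * t.
  by rewrite eE tE [x ^+ n]exprS; ring.
exact: nil_t.
Qed.

End Nilpotent.

Section StronglyNilStarClean.
Variables (R : comPzRingType) (star : R -> R).

(** If [x = p + w], then [x - x ^+ 2] is a multiple of [w], and an idempotent [x] must coincide with
    [p], from which it differs by a nilpotent. Conversely, an idempotent lifting [x] is self-adjoint
    by assumption and serves as the projection. *)
Lemma strongly_nil_star_cleanP :
  strongly_nil_star_clean star <->
  (forall x : R, is_nilpotent (x - x ^+ 2)) /\
  (forall e : R, e ^+ 2 = e -> star e = e).
Proof.
split=> [clean | [nil idem] x].
  split=> [x | e ee].
    have [p [w [[pp _] nw _ ->]]] := clean x.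
    have -> : p + w - (p + w) ^+ 2 = p - p ^+ 2 + (1 - 2 * p - w) * w by ring.
    by rewrite pp subrr add0r; apply: nilpotentMl.
  have [p [w [[pp sp] nw _ eE]]] := clean e.
  suff -> : e = p by [].
  by apply: idempotent_eq_mod_nilpotent => //; rewrite eE addrC addKr.
have [e ee nxe] := idempotent_lift _ _ (nil x).
exists e, (x - e); split=> //; first by split=> //; exact: idem.
  exact: mulrC.
by rewrite addrC subrK.
Qed.

Hypothesis star_inv : is_involution star.

Lemma involution1 : star 1 = 1.
Proof.
have [_ sM sK] := star_inv.
by rewrite -[RHS]sK -[star 1 in RHS]mulr1 sM sK mulr1.
Qed.

Lemma involutionX x n : star (x ^+ n) = star x ^+ n.
Proof.
have [_ sM _] := star_inv.
by elim: n => [|n IHn]; rewrite ?expr0 ?involution1 // exprS exprSr sM IHn.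
Qed.

Lemma involution0 : star 0 = 0.
Proof.
have [sD _ _] := star_inv.
by apply: (addrI (star 0)); rewrite -sD !addr0.
Qed.

(** The projection part of [x] cancels, leaving [star w - w] with [w] nilpotent. *)
Lemma strongly_nil_star_clean_adjoint x :
  strongly_nil_star_clean star -> is_nilpotent (star x - x).
Proof.
have [sD _ _] := star_inv.
case/(_ x)=> p [w [[_ sp] nw _ ->]]; rewrite sD sp opprD addrACA subrr add0r.
apply: nilpotentB => //; case: nw => n wn0.
by exists n; rewrite -involutionX wn0 involution0.
Qed.

End StronglyNilStarClean.

Lemma boolean_mod_nilpotent_2 (R : comPzRingType) :
  (forall x : R, is_nilpotent (x - x ^+ 2)) -> is_nilpotent (2 : R).
Proof.
(* At [x = 2] the hypothesis concerns [2 - 4 = - 2]. *)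
by move/(_ 2)/nilpotentN; congr is_nilpotent; ring.
Qed.

Section QuadExtNilpotent.
Variables (R : comPzRingType) (mu eta : R).
Local Notation Q := (quad_ext mu eta).
Local Notation mk := (@QuadExt R mu eta).
Local Notation const := (@quad_const R mu eta).
Local Notation i := (@quad_i R mu eta).

Lemma quad_constX a n : const (a ^+ n) = const a ^+ n.
Proof.
by elim: n => // n IHn; rewrite !exprS -IHn; congr mk => /=; ring.
Qed.

Lemma nilpotent_quad_const a : is_nilpotent (const a) <-> is_nilpotent a.
Proof.
split=> -[n an0]; exists n; last by rewrite -quad_constX an0.
by move: an0; rewrite -quad_constX => -[].
Qed.

Lemma nilpotent_quad_ext a b :
  is_nilpotent a -> is_nilpotent b -> is_nilpotent (mk a b).
Proof.
move=> /nilpotent_quad_const na /nilpotent_quad_const nb.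
rewrite quad_extE; apply: nilpotentD => //.
by rewrite mulrC; apply: nilpotentMl.
Qed.

Lemma nilpotent_quad_i_sub_sqr :
  (forall x : R, is_nilpotent (x - x ^+ 2)) ->
  is_nilpotent (i - i ^+ 2) <-> is_nilpotent (mu * eta).
Proof.
move=> nil; have nil2 := boolean_mod_nilpotent_2 R nil.
have defect : is_nilpotent ((i - i ^+ 2) ^+ 2 - const (mu * eta)).
  (* As [i - i ^+ 2 = - eta + (1 - mu) i], both coordinates of the defect are combinations of the
     nilpotents [2], [mu - mu ^+ 2] and [eta - eta ^+ 2]. *)
  have -> : (i - i ^+ 2) ^+ 2 - const (mu * eta)
    = mk ((eta - mu * eta) * 2 - eta * (mu - mu ^+ 2) - (eta - eta ^+ 2))
         ((1 - mu) * (mu - mu ^+ 2) - eta * (1 - mu) * 2).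
    by rewrite !expr2; congr mk => /=; ring.
  apply: nilpotent_quad_ext; last by apply: nilpotentB; apply: nilpotentMl.
  by do 2![apply: nilpotentB => //]; apply: nilpotentMl.
split=> [ni | /nilpotent_quad_const nme].
  apply/nilpotent_quad_const; rewrite -[const _](subKr ((i - i ^+ 2) ^+ 2)).
  by apply: nilpotentB => //; rewrite expr2; apply: nilpotentMl.
by apply: nilpotent_sqr; rewrite -[_ ^+ 2](subrK (const (mu * eta)));
   apply: nilpotentD.
Qed.

Lemma nilpotent_quad_sub_sqr :
  (forall z : Q, is_nilpotent (z - z ^+ 2)) <->
  (forall x : R, is_nilpotent (x - x ^+ 2)) /\ is_nilpotent (mu * eta).
Proof.
split=> [nilQ | [nil nme] [a b]].
  have nil (x : R) : is_nilpotent (x - x ^+ 2).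
    apply/nilpotent_quad_const; have := nilQ (const x).
    by congr is_nilpotent; rewrite !expr2; congr mk => /=; ring.
  by split=> //; apply/nilpotent_quad_i_sub_sqr.
have nil2 := boolean_mod_nilpotent_2 R nil.
have ni : is_nilpotent (i - i ^+ 2) by apply/nilpotent_quad_i_sub_sqr.
(* The second summand collects the error of replacing [a ^+ 2] by [a], [b ^+ 2] by [b] and the cross
   term [2 a b] by zero. *)
have -> : mk a b - mk a b ^+ 2 =
    const b * (i - i ^+ 2)
    + mk (a - a ^+ 2 + eta * (b - b ^+ 2)) (mu * (b - b ^+ 2) - a * b * 2).
  by rewrite !expr2; congr mk => /=; ring.
apply: nilpotentD; first exact: nilpotentMl.
apply: nilpotent_quad_ext; first by apply: nilpotentD => //; apply: nilpotentMl.
by apply: nilpotentB; apply: nilpotentMl.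
Qed.

End QuadExtNilpotent.

Theorem proposition3p1 (R : comPzRingType) (star : R -> R)
    (star_inv : is_involution star)
    (mu eta : R) (star_mu : star mu = mu) (star_eta : star eta = eta) :
  strongly_nil_star_clean (@quad_star R mu eta star) <->
  strongly_nil_star_clean star /\ is_nilpotent (mu * eta).
Proof.
have qstar_inv := quad_star_involution star_inv star_mu star_eta.
split=> [/strongly_nil_star_cleanP[nilQ idem] | [clean nme]].
  have [nil nme] := (nilpotent_quad_sub_sqr R mu eta).1 nilQ.
  split=> //; apply/strongly_nil_star_cleanP; split=> // e ee.
  (* An idempotent of [R] stays idempotent as a constant of R[i], where the adjoint acts
     coordinatewise. *)
  have := idem (quad_const mu eta e); rewrite -quad_constX ee.
  by case/(_ erefl).
have [nil _] := (strongly_nil_star_cleanP _ _).1 clean.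
apply/strongly_nil_star_cleanP; split.
  exact: (nilpotent_quad_sub_sqr R mu eta).2.
(* The adjoint of an idempotent is again idempotent, and here the difference has the nilpotent
   coordinates [star a - a] and [star b - b]. *)
move=> [a b] ee; apply: idempotent_eq_mod_nilpotent => //.
  by rewrite -involutionX // ee.
by apply: nilpotent_quad_ext; apply: strongly_nil_star_clean_adjoint.
Qed.
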